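(* Let $p\in(0,1)$ be fixed and let $r\ge 3$. Let $k\ge r+1$ be the least integer satisfying $\frac{k!}{(k-r)!\,k^r}>p$. Then $$\frac{H_r(n,p)}{E(n,p)}\ge\left(\frac{(k-r+1)!\,k^{r-1}}{k!}\right)^{n-o(n)}$$ (as $n\to\infty$ over those $n$ for which $p\binom{n}{r}$ is an integer).
   Context: An $r$-graph $G$ has a vertex set and an edge set consisting of $r$-element subsets of the vertex set. An $n$-vertex $r$-graph has density $p$ if it has exactly $p\binom{n}{r}$ edges. A Hamiltonian cycle of an $n$-vertex $r$-graph $G$ is given by an ordering $v_1,\dots,v_n$ of its vertices such that for every $i$ the set $\{v_i,\dots,v_{i+r-1}\}$ (indices modulo $n$) is an edge; the cycle is identified with this set of $n$ edges. $H(G)$ is the number of Hamiltonian cycles of $G$. $H_r(n,p)$ is the maximum of $H(G)$ over all $n$-vertex $r$-graphs of density $p$. $E(n,p)=p^n(n-1)!/2$. *)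

(* Defs.v *)
From HB Require Import structures.
From mathcomp Require Import all_boot all_order all_algebra.
From mathcomp Require Import all_classical all_reals all_analysis.
Set Implicit Arguments. Unset Strict Implicit. Unset Printing Implicit Defensive.
Import Order.TTheory GRing.Theory Num.Theory.
Local Open Scope ring_scope.

Definition is_rgraph (n r : nat) (G : {set {set 'I_n}}) : bool :=
  [forall e in G, #|e| == r].

(* Edge set of the Hamiltonian cycle given by the ordering s = v_1 ... v_n:
   the windows {v_i, ..., v_{i+r-1}} (indices mod n), i.e. the first r
   entries of the i-th rotation of s. *)
Definition cycle_edges (n r : nat) (s : seq 'I_n) : {set {set 'I_n}} :=
  [set [set x in take r (rot i s)] | i : 'I_(size s)].

Definition ham_cycles (n r : nat) (G : {set {set 'I_n}}) : {set {set {set 'I_n}}} :=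
  [set C : {set {set 'I_n}} | (C \subset G) &&
     [exists s : n.-tuple 'I_n, uniq s && (C == cycle_edges r s)]].

Definition Hcount (n r : nat) (G : {set {set 'I_n}}) : nat := #|ham_cycles r G|.

Definition has_density {R : realType} (n r : nat) (p : R) (G : {set {set 'I_n}}) : bool :=
  (#|G|%:R == p * ('C(n, r))%:R).

Definition Hmax {R : realType} (r n : nat) (p : R) : nat :=
  \max_(G : {set {set 'I_n}} | is_rgraph r G && has_density r p G) Hcount r G.

Definition Eexp {R : realType} (n : nat) (p : R) : R :=
  p ^+ n * ((n.-1)`!)%:R / 2.

Definition falling_ratio {R : realType} (r k : nat) : R :=
  (k`!)%:R / (((k - r)`!)%:R * (k%:R) ^+ r).

Definition base_const {R : realType} (r k : nat) : R :=
  (((k - r).+1)`! * k ^ r.-1)%:R / (k`!)%:R.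

(* Main.v *)
Require Import Defs.
From HB Require Import structures.
From mathcomp Require Import all_boot all_order all_algebra all_fingroup.
From mathcomp Require Import all_classical all_reals all_analysis.
From mathcomp Require Import zify ring.
Import Order.TTheory GRing.Theory Num.Theory numFieldNormedType.Exports.
Set Implicit Arguments. Unset Strict Implicit. Unset Printing Implicit Defensive.

(** Colour the vertices with k colours and fix one vertex z.  Allow an r-set as an edge if it is
    rainbow or contains z.  An ordering that starts at z gives a Hamiltonian cycle of allowed edges
    as soon as its windows avoiding z are rainbow, and these windows do not wrap around; so for each
    ordering at least (k-r+1)^n colourings are suitable, and some pair (colouring, z) has at least
    (n-1)! ((k-r+1)/k)^n suitable orderings.  A cycle arises from at most n^r orderings, since it
    and the first r vertices determine the ordering.

    By Maclaurin's inequality every colouring has at most falling_ratio r k * n^r / r! rainbow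
    r-sets, and only O(n^(r-1)) sets contain z.  Deleting allowed edges one at a time, always one
    contained in the fewest cycles, down to p 'C(n, r) edges keeps a proportion
    (p / falling_ratio r k - O(1/n))^n of the cycles.  As
    (k-r+1) / k = base_const r k * falling_ratio r k, this leaves n^(-O(1)) (base_const r k * x_n)^n
    times Eexp n p cycles, where x_n tends to 1. *)

(** * Counting Hamiltonian cycles *)

Lemma nth_rot_mod (T : Type) (x0 : T) (s : seq T) i j :
  i < size s -> j < size s -> nth x0 (rot i s) j = nth x0 s ((i + j) %% size s).
Proof.
move=> ilt jlt; rewrite /rot nth_cat size_drop; case: ltnP => h.
  by rewrite nth_drop modn_small //; lia.
rewrite nth_take; last by lia.
rewrite (_ : i + j = j - (size s - i) + size s); last by lia.
by rewrite modnDr modn_small //; lia.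
Qed.

Lemma mem_window (T : eqType) (x0 : T) (s : seq T) i r x :
  i < size s -> r <= size s ->
  reflect (exists2 j, j < r & x = nth x0 s ((i + j) %% size s))
          (x \in take r (rot i s)).
Proof.
move=> ilt rle; have szr : size (take r (rot i s)) = r.
  by rewrite size_takel // size_rot.
apply: (iffP (nthP x0)); rewrite szr => -[j jr].
  by rewrite nth_take // nth_rot_mod ?(leq_trans jr) // => <-; exists j.
by move=> ->; exists j; rewrite // nth_take // nth_rot_mod // (leq_trans jr).
Qed.

(* The only windows of s containing s_(m-r+1), ..., s_(m-1) start at m-r and at m-r+1, so s_m is
   forced by the edge set and the preceding vertices. *)
Lemma cycle_edges_take_inj (n r : nat) (s t : seq 'I_n) :
    uniq s -> uniq t -> size s = n -> size t = n -> 3 <= r -> r.*2 <= n ->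
  cycle_edges r s = cycle_edges r t -> take r s = take r t -> s = t.
Proof.
move=> us ut ss st r3 r2n ce te.
have rn : r <= n by lia.
have n0 : 0 < n by lia.
have x0 := Ordinal n0.
apply: (@eq_from_nth _ x0); first by rewrite ss st.
move=> m; rewrite ss; elim/ltn_ind: m => m IH mn.
have [mr|rm] := ltnP m r; first by rewrite -(nth_take x0 mr) te nth_take.
have inx : forall a b, a < n -> b < n -> nth x0 t a = nth x0 t b -> a = b.
  by move=> a b an bn /eqP; rewrite nth_uniq ?st // => /eqP.
have insx : forall a b, a < n -> b < n -> nth x0 s a = nth x0 s b -> a = b.
  by move=> a b an bn /eqP; rewrite nth_uniq ?ss // => /eqP.
(* The window of [t] ending at position [m]: its first [r.-1] entries are already known to agree
   with [s]. As a set it is also the window of [s] starting at some [j]. *)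
have qlt : m - r.-1 < size t by lia.
have : [set x in take r (rot (m - r.-1) t)]%SET \in cycle_edges r t.
  by apply/imsetP; exists (Ordinal qlt).
rewrite -ce => /imsetP [[j jlt] _ /= E].
have wt c : c < r ->
    exists2 e, e < r & nth x0 t (m - r.-1 + c) = nth x0 s ((j + e) %% n).
  move=> cr; have : nth x0 t (m - r.-1 + c) \in [set x in take r (rot (m - r.-1) t)]%SET.
    rewrite inE; apply/(mem_window x0) => //; first by rewrite st.
    by exists c => //; rewrite st modn_small //; lia.
  rewrite E inE => /(mem_window x0 _ jlt)[|e er]; first by rewrite ss.
  by rewrite ss => ?; exists e.
rewrite ss in jlt.
(* Before [m] the sequences agree, so injectivity of [s] turns equality of vertices into equality of
   positions. *)
have pos c e : c < r.-1 -> e < r -> nth x0 t (m - r.-1 + c) = nth x0 s ((j + e) %% n) ->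
    m - r.-1 + c = (j + e) %% n.
  move=> cr er; rewrite -IH; [|lia|lia] => /insx -> //; [lia|exact: ltn_pmod].
(* Offsets [0] and [r.-2] are the ends of the known part; locating both in the window of [s] leaves
   only [m - r] and [m - r.-1] for [j]. Offset [r.-1] is the vertex to be identified. *)
have [e0 e0r /pos p0] := wt 0 ltac:(lia).
have [e1 e1r /pos p1] := wt r.-2 ltac:(lia).
have [e2 e2r] := wt r.-1 ltac:(lia).
rewrite subnK; last lia.
have {}p0 := p0 ltac:(lia) e0r.
have {}p1 := p1 ltac:(lia) e1r.
have md e : e < r -> (j + e) %% n = if j + e < n then j + e else j + e - n.
  move=> er; case: ltnP => h; first by rewrite modn_small.
  by rewrite -{1}(subnK h) modnDr modn_small //; lia.
rewrite !md // in p0 p1 *.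
move=> E2.
suff Em : m = (if j + e2 < n then j + e2 else j + e2 - n) by rewrite E2 -Em.
set q := (if j + e2 < n then _ else _) in E2 *.
have qn : q < n by rewrite /q; case: ifP; lia.
(* If [q < m], induction gives that [t] has the same vertex at [q] and at [m], against [uniq t]. *)
have [mq|mq] := leqP m q; last first.
  by move: E2; rewrite IH // => /inx; lia.
move: p0 p1 mq; rewrite /q.
by case: (ltnP (j + e0)); case: (ltnP (j + e1)); case: (ltnP (j + e2)); lia.
Qed.

(** * Averaging and edge deletion *)

Lemma sum_le_card_max (T : finType) (A : {pred T}) (f : T -> nat) x0 :
  x0 \in A -> exists2 x, x \in A & \sum_(y in A) f y <= #|A| * f x.
Proof.
move=> x0A; case: (arg_maxnP f x0A) => x xA xmax; exists x => //.
by rewrite -sum_nat_const; apply: leq_sum => y /xmax.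
Qed.

(** Double counting of pairs [(e, C)] with [C] inside [G] and [e] in [G] but not in [C]: each such
    [C] misses at least [m.+1 - n] edges, and the best [e] does at least as well as the average. *)
Lemma deletion_step (T : finType) (F : {set {set T}}) n (G : {set T}) m :
    (forall C, C \in F -> #|C| <= n) -> #|G| = m.+1 ->
  exists2 e, e \in G &
    (m.+1 - n) * #|[set C in F | C \subset G]%SET|
      <= m.+1 * #|[set C in F | C \subset (G :\ e)]%SET|.
Proof.
move=> Fn Gm; have /card_gt0P[e0 e0G] : 0 < #|G| by rewrite Gm.
have [e eG] := sum_le_card_max (fun e => #|[set C in F | C \subset (G :\ e)]%SET|) e0G.
rewrite Gm => le; exists e => //; apply: leq_trans le.
under eq_bigr do rewrite -sum1_card.
rewrite (exchange_big_dep (mem [set C in F | C \subset G]%SET)) /=; last first.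
  by move=> i C iG; rewrite !inE subsetD1 => /and3P[-> -> _].
rewrite mulnC -sum_nat_const; apply: leq_sum => C; rewrite inE => /andP[CF CG].
rewrite (eq_bigl (mem (G :\: C))) => [|x]; last first.
  by rewrite !inE CF subsetD1 CG /= andbC.
by rewrite sum1_card cardsDS // Gm leq_sub2l // Fn.
Qed.

(** Iterating [deletion_step] loses a factor [(j - n) / j] for each [j] from [m + 1] to [#|G|]; the
    product telescopes to a ratio of falling factorials. *)
Lemma deletion (T : finType) (F : {set {set T}}) n (G : {set T}) m :
    (forall C, C \in F -> #|C| <= n) -> m <= #|G| ->
  exists2 G' : {set T}, G' \subset G /\ #|G'| = m &
    #|[set C in F | C \subset G]%SET| * m ^_ n
      <= #|[set C in F | C \subset G']%SET| * #|G| ^_ n.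
Proof.
move=> Fn; move: {2}(#|G| - m) (erefl (#|G| - m)) => q; elim: q G => [|q IH] G Eq mG.
  by exists G => //; rewrite (_ : #|G| = m) //; lia.
have Gm : #|G| = (m + q).+1 by lia.
have [e eG le] := deletion_step Fn Gm.
have Ge : #|G :\ e| = m + q by move: (cardsD1 e G); rewrite eG; lia.
have [G' [G'G cG'] le'] := IH (G :\ e) ltac:(lia) ltac:(lia).
exists G'; first by rewrite (fintype.subset_trans G'G (subD1set _ _)).
(* For [m < n] the left side vanishes; otherwise [(m + q).+1 - n] is positive and can be
   cancelled. *)
have [nm|mn] := leqP n m; last by rewrite ffact_small // muln0.
have E : (m + q).+1 * (m + q) ^_ n = (m + q).+1 ^_ n * ((m + q).+1 - n).
  by rewrite -ffactSS ffactnSr.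
rewrite -(leq_pmul2r (_ : 0 < (m + q).+1 - n)); last lia.
rewrite Gm -[leqRHS]mulnA -E [leqRHS]mulnCA.
rewrite Ge in le'.
apply: leq_trans (leq_mul (leqnn _) le').
by rewrite mulnAC [leqRHS]mulnA leq_mul2r mulnC le orbT.
Qed.

(** * Colour words whose windows are rainbow *)

Fixpoint spaced (C : eqType) (r : nat) (w : seq C) : bool :=
  if w is c :: w' then (c \notin take r.-1 w') && spaced r w' else true.

Lemma spaced_nth (C : eqType) r (w : seq C) x0 i j :
  spaced r w -> i < j < i + r -> j < size w -> nth x0 w i != nth x0 w j.
Proof.
elim: w i j => [|c w IH] [|i] [|j] //=; last first.
  by rewrite addSn !ltnS => /andP[_ sw] *; apply: IH.
move=> /andP[cw sw]; rewrite add0n ltnS => jr jw; apply: contraNneq cw => ->.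
rewrite -(nth_take x0 (_ : j < r.-1)); last lia.
by rewrite mem_nth // size_take; case: ifP; lia.
Qed.

(** Choose the entries from right to left: each new head has to avoid at most [r.-1] colours. *)
Lemma card_spaced k r n :
  (k - r.-1) ^ n <= #|[set w : n.-tuple 'I_k | spaced r w]%SET|.
Proof.
elim: n => [|n IH].
  by rewrite expn0; apply/card_gt0P; exists [tuple]; rewrite inE.
pose D := [set x : 'I_k * n.-tuple 'I_k | spaced r x.2 && (x.1 \notin take r.-1 x.2)]%SET.
pose f (x : 'I_k * n.-tuple 'I_k) := [tuple of x.1 :: x.2].
have finj : injective f.
  by move=> [c w] [c' w'] /(congr1 val) [-> /val_inj ->].
apply: leq_trans (_ : #|D| <= _); last first.
  rewrite -(card_imset _ finj); apply: subset_leq_card; apply/fintype.subsetP => _ /imsetP[x + ->].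
  by rewrite !inE /= andbC.
rewrite -sum1_card (eq_bigl _ _ (fun x => finset.in_set _ _)).
rewrite -(pair_big_dep xpredT
  (fun c (w : n.-tuple 'I_k) => spaced r w && (c \notin take r.-1 w)) (fun _ _ => 1)) /=.
rewrite (exchange_big_dep (fun w : n.-tuple 'I_k => spaced r w)) /=; last first.
  by move=> c w _ /andP[].
rewrite expnS mulnC.
apply: leq_trans (leq_mul IH (leqnn _)) _; rewrite -sum_nat_const.
rewrite (eq_bigl _ _ (fun x => finset.in_set _ _)); apply: leq_sum => w sw.
rewrite (eq_bigl (mem [predC take r.-1 w])) => [|c]; last by rewrite !inE sw.
rewrite sum1_card -[k in leqLHS]card_ord -(cardC (mem (take r.-1 w))) leq_subLR leq_add //.
apply: leq_trans (card_size _) _.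
by rewrite size_take; case: ltnP; lia.
Qed.

(** * Maclaurin's inequality for rainbow sets *)

Definition rainbow (V C : finType) (phi : V -> C) (m : nat) : {set {set V}} :=
  [set S : {set V} | (#|S| == m) && (#|phi @: S| == #|S|)]%SET.

Lemma rainbow_setU1 (V C : finType) (phi : V -> C) m (Q : {set V}) x :
  x \notin Q ->
  (x |: Q \in rainbow phi m.+1)%SET = (Q \in rainbow phi m) && (phi x \notin phi @: Q)%SET.
Proof.
move=> xQ; rewrite !inE imsetU1 !cardsU1 xQ add1n eqSS -andbA; congr andb.
have le : #|(phi @: Q)%SET| <= #|Q| := leq_imset_card _ _.
by apply/idP/idP; case: (_ \notin _) => /=; rewrite ?andbT ?andbF; lia.
Qed.

Lemma sum_rainbow_setU1 (A : nmodType) (V C : finType) (phi : V -> C) m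
    (F : {set V} -> V -> A) :
  (\sum_(S in rainbow phi m.+1) \sum_(x in S) F S x =
   \sum_(Q in rainbow phi m) \sum_(x | phi x \notin phi @: Q) F (x |: Q)%SET x)%R.
Proof.
rewrite !pair_big_dep /=.
rewrite (reindex_onto (fun q : {set V} * V => ((q.2 |: q.1)%SET, q.2))
           (fun q : {set V} * V => ((q.1 :\ q.2)%SET, q.2))) /=; last first.
  by case=> S x /= /andP[_ xS]; rewrite finset.setD1K.
apply: eq_bigl => -[Q x] /=; rewrite setU11 andbT.
have [xQ|xQ] := boolP (x \in Q).
  have -> : (phi x \notin phi @: Q)%SET = false by rewrite imset_f.
  rewrite andbF; apply/negbTE; rewrite negb_and; apply/orP; right.
  by apply: contraTneq xQ => -[<-]; rewrite !inE eqxx.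
by rewrite rainbow_setU1 // finset.setU1K // eqxx andbT.
Qed.

Section Maclaurin.
Variables (V C : finType) (phi : V -> C).
Local Open Scope ring_scope.
(** The size of a colour class, taken in [int] because differences of sizes occur below. The number
    of rainbow [m]-sets is the [m]-th elementary symmetric polynomial in these sizes. *)
Let a (c : C) : int := #|[set x | phi x == c]%SET|%:R.

Lemma sum_by_color (B : {set C}) (f : C -> int) :
  \sum_(x | phi x \notin B) f (phi x) = \sum_(c | c \notin B) a c * f c.
Proof.
rewrite (partition_big phi (fun c => c \notin B)) //=.
apply: eq_bigr => c cB.
rewrite (eq_bigl (mem [set x | phi x == c]%SET)) => [|x]; last first.
  by rewrite !inE; case: eqP => [->|]; rewrite ?cB ?andbF.
rewrite (eq_bigr (fun _ => f c)) => [|x /=]; last by rewrite finset.in_set => /eqP ->.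
by rewrite sumr_const mulr_natl.
Qed.

Lemma rainbowS_card m :
  m.+1%:R * #|rainbow phi m.+1|%:R =
  \sum_(Q in rainbow phi m) \sum_(c | c \notin (phi @: Q)%SET) a c.
Proof.
transitivity (\sum_(S in rainbow phi m.+1) \sum_(x in S) (1 : int)).
  rewrite (eq_bigr (fun=> m.+1%:R)) => [|S]; last first.
    by rewrite inE => /andP[/eqP Sm _]; rewrite sumr_const Sm.
  by rewrite sumr_const mulr_natr.
rewrite sum_rainbow_setU1; apply: eq_bigr => Q _.
rewrite (sum_by_color _ (fun=> 1)).
by apply: eq_bigr => c _; rewrite mulr1.
Qed.

Lemma sum_color : \sum_c a c = #|V|%:R.
Proof.
transitivity (\sum_(x : V | phi x \notin finset.set0) (1 : int)); last first.
  by rewrite (eq_bigl predT) ?sumr_const // => x; rewrite finset.in_set0.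
rewrite (sum_by_color _ (fun=> 1)); apply: eq_big => [c|c _]; first by rewrite inE.
by rewrite mulr1.
Qed.

(** The sizes in [B] add up to [#|V|] minus those outside. With [B] the colours of a rainbow set,
    the right side is the contribution of that set to the difference of the two sides of
    [maclaurin_step]. *)
Lemma sum_sub_compl (B : {set C}) :
  \sum_(i in B) \sum_(j | j \notin B) (a i - a j) =
  (#|C|%:R - #|B|%:R) * #|V|%:R - #|C|%:R * \sum_(j | j \notin B) a j.
Proof.
have cc : (#|[predC B]|%:R = #|C|%:R - #|B|%:R :> int).
  by rewrite -(cardC (mem B)) natrD addrAC subrr add0r.
rewrite -sum_color [in RHS](bigID (mem B)) /=.
transitivity (\sum_(i in B) (a i * #|[predC B]|%:R - \sum_(j | j \notin B) a j)).
  by apply: eq_bigr => i _; rewrite sumrB sumr_const mulr_natr.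
rewrite sumrB sumr_const -mulr_suml cc -[X in _ - X]mulr_natr; ring.
Qed.

(* Exchanging i and j turns the sum into half the sum of the squares of a i - a j. *)
Lemma sum_mul_sub_ge0 (B : {set C}) :
  0 <= \sum_(i | i \notin B) a i * \sum_(j | j \notin B) (a i - a j).
Proof.
set X := \sum_(i | _) _.
have X1 : X = \sum_(i | i \notin B) \sum_(j | j \notin B) a i * (a i - a j).
  by apply: eq_bigr => i _; rewrite mulr_sumr.
have X2 : X = \sum_(i | i \notin B) \sum_(j | j \notin B) a j * (a j - a i).
  by rewrite X1 exchange_big.
rewrite -(pmulr_rge0 _ (_ : 0 < 2%:R)) // mulr_natl mulr2n {1}X1 X2 -big_split /=.
apply: sumr_ge0 => i _; rewrite -big_split /=; apply: sumr_ge0 => j _.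
rewrite (_ : _ + _ = (a i - a j) ^+ 2) ?sqr_ge0 //; ring.
Qed.

(** The difference of the sides is a sum over rainbow [S] and [x] in [S]. Regrouped by [Q], the set
    [S] without [x], it consists of the nonnegative sums of [sum_mul_sub_ge0]. *)
Lemma maclaurin_step m :
  #|C|%:R * m.+1%:R * #|rainbow phi m.+1|%:R <=
    (#|C|%:R - m%:R) * #|V|%:R * #|rainbow phi m|%:R :> int.
Proof.
rewrite -mulrA rainbowS_card -subr_ge0 mulr_natr -sumr_const mulr_sumr -sumrB.
set X := \sum_(S in _) _.
have {X}-> : X = \sum_(S in rainbow phi m) \sum_(x in S)
                   \sum_(j | j \notin (phi @: S)%SET) (a (phi x) - a j).
  apply: eq_bigr => S; rewrite inE => /andP[/eqP <- /[dup] /eqP E /imset_injP inj].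
  by rewrite -[in #|S|%:R]E -sum_sub_compl big_imset.
case: m => [|m].
  rewrite big1 // => S; rewrite inE => /andP[/eqP/cards0_eq -> _].
  by rewrite big_set0.
rewrite sum_rainbow_setU1; apply: sumr_ge0 => Q _.
(* The term [j = phi x] is zero, so [j] may range over all colours outside those of [Q],
   independently of [x]. *)
rewrite (eq_bigr (fun x => \sum_(j | j \notin (phi @: Q)%SET) (a (phi x) - a j))).
  by rewrite (sum_by_color _ (fun c => \sum_(j | j \notin (phi @: Q)%SET) (a c - a j)))
             sum_mul_sub_ge0.
move=> x xQ; rewrite [RHS](bigD1 (phi x)) //= subrr add0r.
by apply: eq_bigl => j; rewrite imsetU1 !inE negb_or andbC.
Qed.

End Maclaurin.

Lemma maclaurin (V C : finType) (phi : V -> C) m :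
  m <= #|C| -> m`! * #|C| ^ m * #|rainbow phi m| <= #|C| ^_ m * #|V| ^ m.
Proof.
elim: m => [|m IH] mC.
  rewrite fact0 !expn0 ffactn0 !mul1n -(cards1 (finset.set0 : {set V})).
  by apply/subset_leq_card/fintype.subsetP => S; rewrite !inE => /andP[]; rewrite cards_eq0.
have step : #|C| * m.+1 * #|rainbow phi m.+1| <= (#|C| - m) * #|V| * #|rainbow phi m|.
  have := maclaurin_step phi m.
  by rewrite -natrB ?(ltnW mC) // -!natrM ler_nat.
rewrite factS !expnS ffactnSr.
have -> : m.+1 * m`! * (#|C| * #|C| ^ m) * #|rainbow phi m.+1| =
   (m`! * #|C| ^ m) * (#|C| * m.+1 * #|rainbow phi m.+1|) by ring.
apply: leq_trans (leq_mul (leqnn _) step) _.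
have -> : m`! * #|C| ^ m * ((#|C| - m) * #|V| * #|rainbow phi m|) =
   (m`! * #|C| ^ m * #|rainbow phi m|) * ((#|C| - m) * #|V|) by ring.
apply: leq_trans (leq_mul (IH (ltnW mC)) (leqnn _)) _.
by rewrite leq_eqVlt; apply/orP; left; apply/eqP; ring.
Qed.

(** * Graphs with many Hamiltonian cycles *)

Definition allowed (V C : finType) (phi : V -> C) (z : V) (r : nat) : {set {set V}} :=
  [set S : {set V} | (#|S| == r) && ((z \in S) || (#|phi @: S| == #|S|))]%SET.

(* A window that wraps around contains tau ord0 = z, so only the linear windows are constrained. *)
Definition good_perms (n k r : nat) (phi : 'I_n.+1 -> 'I_k) (z : 'I_n.+1) : {set 'S_n.+1} :=
  [set tau : 'S_n.+1 | (tau ord0 == z) && spaced r [seq phi (tau i) | i <- enum 'I_n.+1]]%SET.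

(** Average over all pairs [(phi, z)]. A fixed [tau] forces [z], and each spaced word read along
    [tau] gives one suitable [phi]. The [n.+1] choices of [z] reduce the number of permutations,
    [n.+1] factorial, to [n] factorial. *)
Lemma exists_coloring n k r : 0 < k ->
  exists phi : 'I_n.+1 -> 'I_k, exists z : 'I_n.+1,
    n`! * (k - r.-1) ^ n.+1 <= k ^ n.+1 * #|good_perms r phi z|.
Proof.
move=> k0.
pose g (q : {ffun 'I_n.+1 -> 'I_k} * 'I_n.+1) := good_perms r q.1 q.2.
have [[phi z] _ le] := @sum_le_card_max _ predT (fun q => #|g q|)
  ([ffun=> Ordinal k0], ord0) isT.
exists phi, z; rewrite -(leq_pmul2l (ltn0Sn n)) mulnA -factS.
rewrite card_prod card_ffun !card_ord in le.
rewrite [leqRHS]mulnA [n.+1 * _]mulnC; apply: leq_trans le.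
under eq_bigr do rewrite -sum1_card.
rewrite (exchange_big_dep predT) //= -card_Sn -cardsT -sum_nat_const.
rewrite big_mkcond /= [leqRHS]big_mkcond /=.
apply: leq_sum => tau _; rewrite finset.inE.
apply: leq_trans (card_spaced k r n.+1) _; rewrite sum1_card.
pose h (w : n.+1.-tuple 'I_k) : {ffun 'I_n.+1 -> 'I_k} * 'I_n.+1 :=
  ([ffun x => tnth w ((tau^-1)%g x)], tau ord0).
have hinj : injective h.
  move=> w w' [/ffunP E]; apply: eq_from_tnth => i.
  by have := E (tau i); rewrite !ffunE permK.
rewrite -(card_imset _ hinj); apply/subset_leq_card/fintype.subsetP => _ /imsetP[w + ->].
rewrite finset.in_set => sw; suff : tau \in g (h w) by [].
rewrite finset.in_set eqxx /=.
rewrite (_ : [seq _ | _ <- _] = w) // -[RHS]map_tnth_enum.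
by apply: eq_map => i; rewrite ffunE permK.
Qed.

Lemma allowed_windows n k r (phi : 'I_n.+1 -> 'I_k) z tau :
  0 < r <= n.+1 -> tau \in good_perms r phi z ->
  cycle_edges r (mktuple tau) \subset allowed phi z r.
Proof.
move=> /andP[r0 rn]; rewrite finset.in_set => /andP[/eqP tz sp].
apply/fintype.subsetP => _ /imsetP[[i ilt] _ ->] /=.
have sz : size (mktuple tau) = n.+1 by rewrite size_tuple.
have nt j : j < n.+1 -> nth ord0 (mktuple tau) j = tau (inord j).
  by move=> jn; rewrite -[j in LHS](inordK jn) nth_mktuple.
rewrite sz in ilt.
have ut : uniq (mktuple tau).
  by rewrite map_inj_uniq ?enum_uniq //; exact: perm_inj.
set S := [set _ in _]%SET.
have memS x : reflect (exists2 j, j < r & x = tau (inord ((i + j) %% n.+1))) (x \in S).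
  rewrite finset.in_set; apply: (iffP (mem_window ord0 _ _ _)); rewrite ?sz //.
    by move=> [j jr ->]; exists j => //; rewrite nt // ltn_pmod.
  by move=> [j jr ->]; exists j => //; rewrite nt // ltn_pmod.
rewrite finset.in_set; apply/andP; split.
  apply/eqP; rewrite cardsE; rewrite (card_uniqP _) ?take_uniq ?rot_uniq //.
  by rewrite size_takel // size_rot sz.
(* A wrapping window reaches position 0, where [z] sits, and so does the window with [i = 0]; every
   other window is a run of [r] consecutive entries and is rainbow by [spaced]. *)
have [in0|inr] := ltnP n.+1 (i + r).
  apply/orP; left; apply/memS; exists (n.+1 - i); first lia.
  by rewrite subnKC ?(ltnW ilt) // modnn -tz; congr (tau _); apply/val_inj; rewrite /= inordK.
have [i0|i0] := posnP i.
  apply/orP; left; apply/memS; exists 0; first by lia.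
  by rewrite i0 mod0n -tz; congr (tau _); apply/val_inj; rewrite /= inordK.
apply/orP; right; apply/imset_injP.
have key j j' : j < j' -> j' < r ->
    phi (tau (inord (i + j))) != phi (tau (inord (i + j'))).
  move=> jj jr; have h1 : i + j < n.+1 by lia. have h2 : i + j' < n.+1 by lia.
  have nq q : q < n.+1 ->
      nth (phi (tau ord0)) [seq phi (tau i) | i <- enum 'I_n.+1] q = phi (tau (inord q)).
    move=> qn; rewrite (nth_map ord0) ?size_enum_ord //; congr (phi (tau _)).
    by apply/val_inj; rewrite /= nth_enum_ord // inordK.
  by rewrite -!nq //; apply: (spaced_nth _ sp); [apply/andP; lia|rewrite size_map size_enum_ord].
move=> _ _ /memS[j jr ->] /memS[j' jr' ->]; rewrite !modn_small; [|lia|lia].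
move=> /eqP; case: (ltngtP j j') => [lt|lt|->] //.
  by rewrite (negbTE (key _ _ lt _)).
by rewrite eq_sym (negbTE (key _ _ lt _)).
Qed.

(** By [cycle_edges_take_inj] an ordering is determined by its cycle and its first [r] vertices, and
    there are at most [n.+1 ^ r] choices for the latter. *)
Lemma card_cycles_ge n k r (phi : 'I_n.+1 -> 'I_k) z : 3 <= r -> r.*2 <= n.+1 ->
  #|good_perms r phi z| <=
    n.+1 ^ r * #|[set cycle_edges r (mktuple tau) | tau : 'S_n.+1 in good_perms r phi z]%SET|.
Proof.
move=> r3 rn; set G := good_perms r phi z; set D := imset _ _.
pose f (tau : 'S_n.+1) : {set {set 'I_n.+1}} * {ffun 'I_r -> 'I_n.+1} :=
  (cycle_edges r (mktuple tau), [ffun j : 'I_r => nth ord0 (mktuple tau) j]).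
have finj : injective f.
  move=> s t [E /ffunP F].
  have ut (tau : 'S_n.+1) : uniq (mktuple tau).
    by rewrite map_inj_uniq ?enum_uniq //; exact: perm_inj.
  have rs (tau : 'S_n.+1) : size (take r (mktuple tau)) = r.
    by rewrite size_takel // size_tuple; lia.
  have /cycle_edges_take_inj : take r (mktuple s) = take r (mktuple t).
    apply: (@eq_from_nth _ ord0); rewrite !rs // => j jr.
    by have := F (Ordinal jr); rewrite !ffunE /= !nth_take.
  move=> /(_ (ut s) (ut t) (size_tuple _) (size_tuple _) r3 rn E) /= st.
  apply/permP => i; have := congr1 (fun u => nth ord0 u i) st.
  by rewrite !nth_mktuple.
rewrite -(card_imset _ finj) mulnC.
have -> : #|D| * n.+1 ^ r = #|finset.setX D [set: {ffun 'I_r -> 'I_n.+1}]%SET|.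
  by rewrite finset.cardsX finset.cardsT card_ffun !card_ord.
apply/subset_leq_card/fintype.subsetP => _ /imsetP[tau tG ->].
by rewrite finset.in_setX /= finset.in_setT andbT imset_f.
Qed.

Lemma ffact_le_exp m n : m ^_ n <= m ^ n.
Proof.
elim: n => [|n IH] //; rewrite expnSr ffactnSr leq_mul ?IH //; lia.
Qed.

Lemma bin_le_exp n m : 'C(n, m) <= n ^ m.
Proof. by apply: leq_trans (ffact_le_exp n m); rewrite -bin_ffact leq_pmulr // fact_gt0. Qed.

(** Rainbow sets are bounded by [maclaurin]; a set containing [z] is [z] added to one of at most
    [#|V| ^ r.-1] sets of size [r.-1]. *)
Lemma card_allowed (V C : finType) (phi : V -> C) z r : 0 < r -> r <= #|C| ->
  r`! * #|C| ^ r * #|allowed phi z r| <=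
    #|C| ^_ r * #|V| ^ r + r`! * #|C| ^ r * #|V| ^ r.-1.
Proof.
move=> r0 rC.
have le : #|allowed phi z r| <= #|rainbow phi r| + #|V| ^ r.-1.
  pose D := [set S : {set V} | #|S| == r.-1]%SET.
  apply: leq_trans (_ : #|rainbow phi r :|: [set (z |: S)%SET | S in D]| <= _).
    apply/subset_leq_card/fintype.subsetP => S; rewrite finset.in_setU !finset.in_set.
    move=> /andP[/eqP Sr /orP[zS|->]]; last by rewrite Sr eqxx.
    apply/orP; right; apply/imsetP; exists (S :\ z)%SET; last by rewrite finset.setD1K.
    by rewrite finset.in_set; have := cardsD1 z S; rewrite zS; lia.
  apply: leq_trans (_ : #|rainbow phi r| + #|[set (z |: S)%SET | S in D]| <= _).
    by rewrite cardsU leq_subr.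
  rewrite leq_add2l; apply: leq_trans (leq_imset_card _ _) _.
  by rewrite card_draws bin_le_exp.
apply: leq_trans (leq_mul (leqnn _) le) _; rewrite mulnDr leq_add2r.
exact: maclaurin.
Qed.

Lemma exp_sub_le_ffact m n j : j <= n -> (m - n) ^ j <= m ^_ j.
Proof.
elim: j => [|j IH] jn //; rewrite expnSr ffactnSr leq_mul ?IH //; lia.
Qed.

Lemma exists_card_between (T : finType) (A B : {set T}) m :
  A \subset B -> #|A| <= m -> m <= #|B| ->
  exists D : {set T}, [/\ A \subset D, D \subset B & #|D| = m].
Proof.
move=> AB; elim: m => [|m IH] Am mB.
  by exists A; split=> //; apply/eqP; rewrite -leqn0.
have [Em|Am'] := eqVneq #|A| m.+1; first by exists A.
have [||D [AD DB cD]] := IH; [by rewrite -ltnS ltn_neqAle Am'|exact: ltnW|].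
have /card_gt0P[x] : 0 < #|B :\: D| by rewrite cardsDS // cD subn_gt0.
rewrite finset.in_setD => /andP[xD xB]; exists (x |: D)%SET; split.
- exact: fintype.subset_trans AD (finset.subsetUr _ _).
- by rewrite finset.subUset finset.sub1set xB.
- by rewrite cardsU1 xD cD.
Qed.

(* M0 is the number of allowed sets, which may be less than m; hence the maxn. *)
Lemma exists_rgraph n k r m : 3 <= r -> r.*2 <= n.+1 -> r <= k -> m <= 'C(n.+1, r) ->
  exists2 G : {set {set 'I_n.+1}}, is_rgraph r G /\ #|G| = m &
  exists M0,
    r`! * k ^ r * M0 <= k ^_ r * n.+1 ^ r + r`! * k ^ r * n.+1 ^ r.-1 /\
    n`! * (k - r.-1) ^ n.+1 * (m - n.+1) ^ n.+1 <=
      k ^ n.+1 * n.+1 ^ r * maxn m M0 ^ n.+1 * Hcount r G.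
Proof.
move=> r3 rn rk mC.
have k0 : 0 < k by lia.
have [phi [z le1]] := @exists_coloring n k r k0.
set Al := allowed phi z r.
set F := [set cycle_edges r (mktuple tau) | tau : 'S_n.+1 in good_perms r phi z]%SET.
have le2 : #|good_perms r phi z| <= n.+1 ^ r * #|F| by apply: card_cycles_ge.
pose E := [set S : {set 'I_n.+1} | #|S| == r]%SET.
have cE : #|E| = 'C(n.+1, r) by rewrite card_draws card_ord.
have AE : Al \subset E.
  by apply/fintype.subsetP => S; rewrite !finset.in_set => /andP[].
have [A [AlA AE' cA]] : exists A : {set {set 'I_n.+1}},
    [/\ Al \subset A, A \subset E & #|A| = maxn m #|Al|].
  by apply: exists_card_between; rewrite ?leq_maxr // cE geq_max mC -cE subset_leq_card.
have Fn C : C \in F -> #|C| <= n.+1.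
  move=> /imsetP[tau _ ->]; apply: leq_trans (leq_imset_card _ _) _.
  by rewrite card_ord size_tuple.
have [||G [GA cG] le3] := @deletion _ F n.+1 A m; [exact: Fn|by rewrite cA leq_maxl|].
exists G.
  split=> //; apply/forall_inP => S SG.
  have := fintype.subsetP AE' _ (fintype.subsetP GA _ SG).
  by rewrite finset.in_set.
exists #|Al|; split.
  by have := @card_allowed _ _ phi z r ltac:(lia); rewrite !card_ord; apply.
rewrite -cA.
have FA : [set C in F | C \subset A]%SET = F.
  apply/setP => C; rewrite finset.in_set andb_idr // => /imsetP[tau tG ->].
  by apply: fintype.subset_trans AlA; apply: allowed_windows => //; lia.
have GH : #|[set C in F | C \subset G]%SET| <= Hcount r G.
  apply/subset_leq_card/fintype.subsetP => C; rewrite !finset.in_set.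
  move=> /andP[/imsetP[tau _ ->] ->] /=; apply/existsP; exists (mktuple tau).
  by rewrite eqxx andbT map_inj_uniq ?enum_uniq //; exact: perm_inj.
rewrite FA in le3.
apply: leq_trans (leq_mul le1 (exp_sub_le_ffact m (leqnn _))) _.
apply: leq_trans (leq_mul (leq_mul (leqnn _) le2) (leqnn _)) _.
have -> : k ^ n.+1 * (n.+1 ^ r * #|F|) * m ^_ n.+1 =
          k ^ n.+1 * n.+1 ^ r * (#|F| * m ^_ n.+1) by ring.
apply: leq_trans (leq_mul (leqnn _) le3) _.
have -> : k ^ n.+1 * n.+1 ^ r * #|A| ^ n.+1 * Hcount r G =
          k ^ n.+1 * n.+1 ^ r * (Hcount r G * #|A| ^ n.+1) by ring.
by rewrite leq_mul2l leq_mul ?orbT // ffact_le_exp.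
Qed.

(** * Asymptotics *)

Local Open Scope classical_set_scope.
Local Open Scope ring_scope.

Lemma cvgn_invr (R : realType) : ((fun n : nat => n%:R^-1 : R) : R^nat) @ \oo --> (0 : R).
Proof. by rewrite -cvg_shiftS; exact: cvg_harmonic. Qed.

Lemma cvgn_invrX (R : realType) j :
  ((fun n : nat => n%:R^-1 ^+ j.+1 : R) : R^nat) @ \oo --> (0 : R).
Proof.
elim: j => [|j IH]; first by under eq_fun do rewrite expr1; exact: cvgn_invr.
under eq_fun do rewrite exprS.
have := cvgM (@cvgn_invr R) IH; rewrite mul0r; exact.
Qed.

Lemma cvgn_ffact (R : realType) j :
  ((fun n : nat => (n ^_ j)%:R / n%:R ^+ j : R) : R^nat) @ \oo --> (1 : R).
Proof.
elim: j => [|j IH].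
  by under eq_fun do rewrite ffactn0 expr0 divr1; exact: cvg_cst.
have h : ((fun n : nat => 1 - j%:R * n%:R^-1 : R) : R^nat) @ \oo --> (1 : R).
  have : ((fun n : nat => 1 - j%:R * n%:R^-1 : R) : R^nat) @ \oo --> (1 - j%:R * 0 : R).
    apply: cvgB; first exact: cvg_cst.
    by apply: cvgM; [exact: cvg_cst|exact: cvgn_invr].
  by rewrite mulr0 subr0.
have : ((fun n : nat => (n ^_ j)%:R / n%:R ^+ j * (1 - j%:R * n%:R^-1) : R) : R^nat) @ \oo
    --> (1 * 1 : R) by apply: cvgM.
rewrite mulr1; apply: cvg_trans; apply: near_eq_cvg.
near=> n.
have jn : (j < n)%N by near: n; exact: nbhs_infty_gt.
have n0 : (n%:R : R) != 0 by rewrite pnatr_eq0; lia.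
rewrite /= ffactnSr natrM natrB ?(ltnW jn) // exprS.
by field; rewrite expf_neq0 ?n0.
Unshelve. all: by end_near. Qed.

(** With [s] the square root of [n], the quotient is [2 * ln s / s ^+ 2], at most [2 / s] since
    [ln s] is below [s]. *)
Lemma cvgn_ln_div (R : realType) : ((fun n : nat => ln n%:R / n%:R : R) : R^nat) @ \oo --> (0 : R).
Proof.
have h : ((fun n : nat => 2 * Num.sqrt (n%:R^-1) : R) : R^nat) @ \oo --> (0 : R).
  have : ((fun n : nat => 2 * Num.sqrt (n%:R^-1) : R) : R^nat) @ \oo --> (2 * Num.sqrt 0 : R).
    apply: cvgM; first exact: cvg_cst.
    by apply: continuous_cvg; [exact: sqrt_continuous|exact: cvgn_invr].
  by rewrite sqrtr0 mulr0.
apply: (squeeze_cvgr _ (cvg_cst (0 : R)) h).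
near=> n.
have n1 : (1 <= n)%N by near: n; exact: nbhs_infty_ge.
have n0 : (0 : R) < n%:R by rewrite ltr0n.
have s0 : 0 < Num.sqrt (n%:R : R) by rewrite sqrtr_gt0.
apply/andP; split; first by rewrite divr_ge0 ?ln_ge0 ?ler1n ?ler0n.
have En : n%:R = Num.sqrt (n%:R : R) ^+ 2 by rewrite sqr_sqrtr // ltW.
rewrite sqrtrV ?(ltW n0) //; set s := Num.sqrt n%:R in En s0 *.
rewrite En lnXn // -[ln s *+ 2]mulr_natl -mulrA ler_pM2l // ler_pdivrMr ?exprn_gt0 //.
by rewrite expr2 mulKf ?gt_eqF // ltW // ln_sublinear.
Unshelve. all: by end_near. Qed.

(* With U = f n^r / r! + n^(r-1) this is f (p 'C(n, r) - n) / (p U), written so that the limit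
   is visible. *)
Definition correction (R : realType) (p f : R) (r n : nat) : R :=
  ((n ^_ r)%:R / n%:R ^+ r - r`!%:R / p * n%:R^-1 ^+ r.-1) / (1 + r`!%:R / f * n%:R^-1).

Lemma cvgn_correction (R : realType) (p f : R) r : (2 <= r)%N ->
  (correction p f r : R^nat) @ \oo --> (1 : R).
Proof.
case: r => [|[|r]] // _.
have : (correction p f r.+2 : R^nat) @ \oo -->
    ((1 - r.+2`!%:R / p * 0) / (1 + r.+2`!%:R / f * 0) : R).
  apply: cvgM.
    apply: cvgB; first exact: cvgn_ffact.
    by apply: cvgM; [exact: cvg_cst|exact: cvgn_invrX].
  apply: cvgV; first by rewrite mulr0 addr0 oner_eq0.
  apply: cvgD; first exact: cvg_cst.
  by apply: cvgM; [exact: cvg_cst|exact: cvgn_invr].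
by rewrite !mulr0 subr0 addr0 divr1.
Qed.

(** * The constants and the bound for a fixed number of vertices *)

Lemma falling_ratio_gt0 (R : realType) r k : (0 < k)%N -> 0 < falling_ratio r k :> R.
Proof.
by move=> k0; rewrite /falling_ratio divr_gt0 ?mulr_gt0 ?exprn_gt0 ?ltr0n ?fact_gt0.
Qed.

Lemma ffact_falling_ratio (R : realType) r k : (0 < k)%N -> (r <= k)%N ->
  (k ^_ r)%:R = falling_ratio r k * k%:R ^+ r :> R.
Proof.
move=> k0 rk; rewrite /falling_ratio -(ffact_fact rk) natrM.
have h1 : ((k - r)`!%:R : R) != 0 by rewrite pnatr_eq0 -lt0n fact_gt0.
have h2 : (k%:R : R) != 0 by rewrite pnatr_eq0 -lt0n.
by field; rewrite h1 expf_neq0.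
Qed.

Lemma base_const_falling_ratio (R : realType) r k : (0 < r)%N -> (r <= k)%N ->
  (k - r.-1)%:R = base_const r k * falling_ratio r k * k%:R :> R.
Proof.
case: r => // r _ rk; rewrite /base_const /falling_ratio /= factS !natrM natrX exprS.
have h1 : ((k - r.+1)`!%:R : R) != 0 by rewrite pnatr_eq0 -lt0n fact_gt0.
have h2 : (k%:R : R) != 0 by rewrite pnatr_eq0 -lt0n (leq_trans _ rk).
have h3 : (k`!%:R : R) != 0 by rewrite pnatr_eq0 -lt0n fact_gt0.
rewrite subnSK //.
by field; rewrite h1 h2 h3 expf_neq0.
Qed.

(** The constant is [k ^ r.-1] divided by [k ^_ r.-1], and for [r.-1] at least 2 the falling
    factorial has a factor below [k]. This makes [ln (base_const r k)] a positive divisor in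
    [theorem3]. *)
Lemma base_const_gt1 (R : realType) r k : (3 <= r)%N -> (r <= k)%N -> 1 < base_const r k :> R.
Proof.
move=> r3 rk; rewrite /base_const ltr_pdivlMr ?ltr0n ?fact_gt0 // mul1r ltr_nat.
have rk' : (r.-1 <= k)%N by lia.
rewrite -(ffact_fact rk') (_ : (k - r).+1 = k - r.-1)%N; last lia.
rewrite mulnC ltn_pmul2l ?fact_gt0 //.
case: r r3 rk {rk'} => [|[|r]] // r3 rk; rewrite /= ffactnSr expnSr.
case: r r3 rk => // r r3 rk.
have h := ffact_le_exp k r.+1.
apply: leq_ltn_trans (leq_mul h (leqnn _)) _.
rewrite ltn_pmul2l ?expn_gt0; lia.
Qed.

Lemma Hmax_ge (R : realType) (p : R) r k n m :
    0 < p < 1 -> (3 <= r)%N -> (r <= k)%N -> p <= falling_ratio r k ->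
    (r.*2 <= n.+1)%N -> p * ('C(n.+1, r))%:R = m%:R ->
    0 < correction p (falling_ratio r k) r n.+1 ->
  n`!%:R * p ^+ n.+1 * (base_const r k * correction p (falling_ratio r k) r n.+1) ^+ n.+1
    <= n.+1%:R ^+ r * (Hmax r n.+1 p)%:R.
Proof.
move=> /andP[p0 p1] r3 rk pf rn Em.
have k0 : (0 < k)%N by lia.
have f0 := @falling_ratio_gt0 R r k k0.
have Ef := @ffact_falling_ratio R r k k0 rk.
have Eb := @base_const_falling_ratio R r k (ltnW (ltnW r3)) rk.
move: (falling_ratio r k) (base_const r k) pf f0 Ef Eb => f b pf f0 Ef Eb.
set x := correction _ _ _ _ => x0.
set N : R := n.+1%:R; have N0 : 0 < N by rewrite ltr0n.
have F0 : 0 < r`!%:R :> R by rewrite ltr0n fact_gt0.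
(* A common upper bound for the number of allowed sets and, because [p <= f], for [m]; hence for
   [maxn m M0]. *)
pose U := f * N ^+ r / r`!%:R + N ^+ r.-1.
have U0 : 0 < U by rewrite addr_gt0 ?divr_gt0 ?mulr_gt0 ?exprn_gt0.
have Er : N ^+ r = N * N ^+ r.-1 by rewrite -exprS prednK //; lia.
have EC : 'C(n.+1, r)%:R = (n.+1 ^_ r)%:R / r`!%:R :> R.
  by rewrite -bin_ffact natrM mulfK ?gt_eqF.
have Ex : m%:R - N = p * U * x / f.
  rewrite -Em EC /x /correction -/N /U exprVn Er.
  have D0 : f * N + r`!%:R != 0 by rewrite gt_eqF // addr_gt0 ?mulr_gt0.
  have P0 : N ^+ r.-1 != 0 by rewrite expf_neq0 ?gt_eqF.
  by clearbody N; field; rewrite P0 D0 !gt_eqF.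
clearbody x.
(* Positivity of the correction ensures that the truncated [m - n.+1] is a genuine difference. *)
have mN : (n.+1 <= m)%N.
  by rewrite -(ler_nat R) -subr_ge0 Ex !mulr_ge0 ?invr_ge0 ?ltW.
have mC : (m <= 'C(n.+1, r))%N.
  by rewrite -(ler_nat R) -Em ler_piMl ?ler0n // ltW.
have [G [Gr cG] [M0 [leM0 leH]]] := exists_rgraph r3 rn rk mC.
have HG : (Hcount r G <= Hmax r n.+1 p)%N.
  by apply: (@leq_bigmax_cond _ _ (Hcount r) G); rewrite Gr /has_density cG Em eqxx.
have M0U : (maxn m M0)%:R <= U.
  have mU : m%:R <= U.
    rewrite -Em EC /U ler_wpDr ?exprn_ge0 ?(ltW N0) // mulrA ler_pM2r ?invr_gt0 //.
    by rewrite ler_pM ?ler0n ?(ltW p0) // /N -natrX ler_nat ffact_le_exp.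
  have MU : M0%:R <= U.
    have K0 : 0 < (k%:R : R) ^+ r by rewrite exprn_gt0 // ltr0n.
    rewrite -(ler_pM2l (mulr_gt0 F0 K0)).
    move: leM0; rewrite -(ler_nat R) natrD !natrM !natrX Ef -/N.
    move=> /le_trans; apply; rewrite le_eqVlt; apply/orP; left; apply/eqP.
    by rewrite /U; field; rewrite gt_eqF.
  by rewrite /maxn; case: ifP.
have kU0 : 0 < (k%:R * U) ^+ n.+1 by rewrite exprn_gt0 // mulr_gt0 // ltr0n.
(* After this multiplication the left side is exactly the natural number bounded in
   [exists_rgraph]. *)
rewrite -(ler_pM2r kU0).
have -> : n`!%:R * p ^+ n.+1 * (b * x) ^+ n.+1 * (k%:R * U) ^+ n.+1 =
          (n`! * (k - r.-1) ^ n.+1 * (m - n.+1) ^ n.+1)%:R.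
  rewrite !natrM !natrX (natrB _ mN) -/N Ex Eb.
  by rewrite -!mulrA -!exprMn; congr (_ * _ ^+ _); field; rewrite gt_eqF.
apply: le_trans (_ : (k ^ n.+1 * n.+1 ^ r * maxn m M0 ^ n.+1 * Hmax r n.+1 p)%:R <= _).
  by rewrite ler_nat (leq_trans leH) // leq_mul2l HG orbT.
have leU : (maxn m M0)%:R ^+ n.+1 <= U ^+ n.+1.
  by rewrite lerXn2r ?nnegrE ?ler0n ?(ltW U0).
have -> : N ^+ r * (Hmax r n.+1 p)%:R * (k%:R * U) ^+ n.+1 =
          k%:R ^+ n.+1 * N ^+ r * U ^+ n.+1 * (Hmax r n.+1 p)%:R by rewrite exprMn; ring.
rewrite !natrM !natrX -/N ler_wpM2r ?ler0n // ler_wpM2l //.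
by rewrite mulr_ge0 ?exprn_ge0 ?ler0n ?(ltW N0).
Qed.

Theorem theorem3 (R : realType) (p : R) (r k : nat) :
  0 < p < 1 -> (3 <= r)%N ->
  (r.+1 <= k)%N -> p < falling_ratio r k ->
  (forall j : nat, (r.+1 <= j < k)%N -> falling_ratio r j <= p) ->
  exists g : nat -> R,
    ((fun n : nat => g n / n%:R) : R^nat) @ \oo --> (0 : R^o) /\
    exists N : nat, forall n : nat, (N <= n)%N ->
      (exists m : nat, p * ('C(n, r))%:R = m%:R) ->
      base_const r k `^ (n%:R - g n) <= (Hmax r n p)%:R / Eexp n p.
Proof.
move=> p01 r3 rk pf _.
have [p0 p1] := andP p01.
set b := base_const r k; pose x := correction p (falling_ratio r k) r.
have b1 : 1 < b by apply: base_const_gt1; lia.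
have lb0 : 0 < ln b by rewrite ln_gt0.
have cx : (x : R^nat) @ \oo --> (1 : R) by apply: cvgn_correction; lia.
(* Solves [b] to the power [n - g n] equal to [(b * x n) ^+ n / n ^+ r], the bound of [Hmax_ge]
   after division by [n ^+ r] and without the factors that go into [Eexp]. *)
exists (fun n => (r%:R * ln n%:R - n%:R * ln (x n)) / ln b); split.
  have h : ((fun n : nat => (r%:R * (ln n%:R / n%:R) - ln (x n)) / ln b) : R^nat) @ \oo --> (0 : R).
    have : ((fun n : nat => (r%:R * (ln n%:R / n%:R) - ln (x n)) / ln b) : R^nat) @ \oo
        --> ((r%:R * 0 - ln 1) / ln b : R).
      apply: cvgM; last exact: cvg_cst.
      apply: cvgB; first by apply: cvgM; [exact: cvg_cst|exact: cvgn_ln_div].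
      by apply: continuous_cvg cx; exact: continuous_ln.
    by rewrite mulr0 ln1 subr0 mul0r.
  apply: cvg_trans h; apply: near_eq_cvg; near=> n.
  have n0 : (n%:R : R) != 0.
    by rewrite pnatr_eq0 -lt0n; near: n; exact: nbhs_infty_gt.
  by rewrite /=; field; rewrite n0 gt_eqF.
have [N _ HN] : \forall n \near \oo, 0 < x n by exact: (cvgr_gt _ cx).
exists (maxn N r.*2) => n; rewrite geq_max => /andP[Nn rn] [m Em].
have {HN Nn}xn : 0 < x n by exact: HN.
case: n rn Em xn => [|n] rn Em xn; first by move: rn; lia.
have le := Hmax_ge p01 r3 (ltnW rk) (ltW pf) rn Em xn.
rewrite -/b -/(x _) in le; move: {cx} (x n.+1) xn le => y y0 le.
have b0 : 0 < b := lt_trans ltr01 b1.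
clearbody b.
have n0 : 0 < n.+1%:R :> R by rewrite ltr0n.
have -> : b `^ (n.+1%:R - (r%:R * ln n.+1%:R - n.+1%:R * ln y) / ln b) =
          (b * y) ^+ n.+1 / n.+1%:R ^+ r.
  have by0 : 0 < (b * y) ^+ n.+1 by rewrite exprn_gt0 ?mulr_gt0.
  have nr0 : 0 < n.+1%:R ^+ r :> R by rewrite exprn_gt0.
  apply: ln_inj; rewrite ?posrE ?powR_gt0 ?divr_gt0 //.
  rewrite ln_powR ln_div ?posrE // !lnXn ?mulr_gt0 // lnM ?posrE //.
  move: (ln b) (ln y) (ln n.+1%:R) lb0 => lb ly ln' lb0.
  by rewrite -[_ *+ n.+1]mulr_natl -[_ *+ r]mulr_natl; field; rewrite gt_eqF.
have E0 : 0 < Eexp n.+1 p.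
  by rewrite /Eexp divr_gt0 // mulr_gt0 ?exprn_gt0 // ltr0n fact_gt0.
rewrite ler_pdivlMr // mulrAC ler_pdivrMr ?exprn_gt0 // [leRHS]mulrC.
apply: le_trans le.
rewrite /Eexp /= [leRHS]mulrC ler_pM2l ?exprn_gt0 ?mulr_gt0 //.
(* What remains is the factor [1 / 2] in [Eexp], which is simply given away. *)
rewrite [p ^+ _ * _]mulrC ler_pdivrMr // ler_peMr ?ler1n //.
by rewrite mulr_ge0 ?ler0n // exprn_ge0 // ltW.
Unshelve. all: by end_near. Qed.
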